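(* Let $\Bbbk$ be an algebraically closed field and let $A$ be a finite-dimensional basic $\Bbbk$-algebra with a fixed set of orthogonal primitive idempotents $\{e_\lambda\}_{\lambda\in\Lambda}$ such that $\sum_{\lambda\in\Lambda}e_\lambda=1$. If $A$ is standardly stratified with respect to two different linear orders $\preccurlyeq$ and $\preccurlyeq'$ on $\Lambda$ such that both $\mathcal{F}({}_{\preccurlyeq}\Delta)$ and $\mathcal{F}({}_{\preccurlyeq'}\Delta)$ are closed under cokernels of monomorphisms, then $\mathcal{F}({}_{\preccurlyeq}\Delta)=\mathcal{F}({}_{\preccurlyeq'}\Delta)$.
   Context: All modules are finitely generated left modules. $P_\lambda=Ae_\lambda$, $S_\lambda=P_\lambda/\mathrm{rad}\,P_\lambda$. For a linear order $\preccurlyeq$ on $\Lambda$, the standard module ${}_{\preccurlyeq}\Delta_\lambda$ is the largest quotient of $P_\lambda$ all of whose composition factors $S_\mu$ satisfy $\mu\preccurlyeq\lambda$. $\mathcal{F}({}_{\preccurlyeq}\Delta)$ is the full subcategory of $A$-modules having a finite filtration whose factors are isomorphic to standard modules ${}_{\preccurlyeq}\Delta_\mu$, $\mu\in\Lambda$. $A$ is standardly stratified for $\preccurlyeq$ if for every $\lambda\in\Lambda$ the kernel of $P_\lambda\to{}_{\preccurlyeq}\Delta_\lambda$ has a filtration with factors ${}_{\preccurlyeq}\Delta_\mu$ with $\mu\succ\lambda$. $\mathcal{F}({}_{\preccurlyeq}\Delta)$ is closed under cokernels of monomorphisms if for every exact sequence $0\to L\to M\to N\to0$ with $L,M\in\mathcal{F}({}_{\preccurlyeq}\Delta)$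 one has $N\in\mathcal{F}({}_{\preccurlyeq}\Delta)$. *)

(* Defs.v *)
From HB Require Import structures.
From mathcomp Require Import all_boot all_order all_algebra all_field.
From mathcomp Require Import boolp.

Set Implicit Arguments.
Unset Strict Implicit.
Unset Printing Implicit Defensive.

Import GRing.Theory.
Local Open Scope ring_scope.
Local Open Scope quotient_scope.

(* Submodules are bundled boolean predicates. The library's [submodClosed]    *)
(* cannot be used for this: it does not imply [zmodClosed], which {quot _}    *)
(* requires. Booleans lose no generality, thanks to [asbool].                 *)
Record submod (A : nzRingType) (M : lmodType A) := Submod {
  submod_pred :> {pred M};
  submodP : submod_closed submod_pred }.

Section SubQuotient.
Context {A : nzRingType} {M : lmodType A}.

HB.instance Definition _ (N : submod M) :=
  GRing.isSubmodClosed.Build A M (submod_pred N) (submodP N).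

Record submod_type (N : submod M) :=
  SubmodType { submod_val : M; _ : submod_val \in N }.

HB.instance Definition _ (N : submod M) :=
  [isSub of submod_type N for @submod_val N].
HB.instance Definition _ (N : submod M) := [Choice of submod_type N by <:].
HB.instance Definition _ (N : submod M) :=
  [SubChoice_isSubZmodule of submod_type N by <:].
HB.instance Definition _ (N : submod M) :=
  [SubZmodule_isSubLmodule of submod_type N by <:].

Definition quotmod (N : submod M) := Quotient.quot (submod_pred N).

HB.instance Definition _ (N : submod M) := GRing.Zmodule.on (quotmod N).

Definition quotmod_pi (N : submod M) (x : M) : quotmod N := \pi_(quotmod N) x.

Definition quotmod_scale (N : submod M) (a : A) (x : quotmod N) : quotmod N :=
  quotmod_pi N (a *: repr x).

Lemma quotmod_piE (N : submod M) (x y : M) :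
  (quotmod_pi N x == quotmod_pi N y) = (x - y \in N).
Proof. by rewrite Quotient.idealrBE. Qed.

Lemma quotmod_piB (N : submod M) : zmod_morphism (quotmod_pi N).
Proof. by move=> x y; rewrite /quotmod_pi !piE. Qed.

Lemma quotmod_piK (N : submod M) (x : quotmod N) : quotmod_pi N (repr x) = x.
Proof. exact: reprK. Qed.

Lemma quotmod_scaleE (N : submod M) a (x : M) :
  quotmod_scale a (quotmod_pi N x) = quotmod_pi N (a *: x).
Proof.
apply/eqP; rewrite /quotmod_scale quotmod_piE -scalerBr rpredZ //.
by rewrite -quotmod_piE quotmod_piK.
Qed.

HB.instance Definition _ (N : submod M) :=
  GRing.isZmodMorphism.Build M (quotmod N) (quotmod_pi N) (@quotmod_piB N).

Lemma quotmod_scaleA (N : submod M) a b (v : quotmod N) :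
  quotmod_scale a (quotmod_scale b v) = quotmod_scale (a * b) v.
Proof. by rewrite -[v]quotmod_piK !quotmod_scaleE scalerA. Qed.

Lemma quotmod_scale1 (N : submod M) : left_id 1 (@quotmod_scale N).
Proof. by move=> v; rewrite -[v]quotmod_piK quotmod_scaleE scale1r. Qed.

Lemma quotmod_scaleDr (N : submod M) :
  right_distributive (@quotmod_scale N) +%R.
Proof.
move=> a u v; rewrite -[u]quotmod_piK -[v]quotmod_piK -raddfD !quotmod_scaleE.
by rewrite scalerDr raddfD.
Qed.

Lemma quotmod_scaleDl (N : submod M) (v : quotmod N) :
  {morph (@quotmod_scale N)^~ v : a b / a + b}.
Proof.
by move=> a b; rewrite -[v]quotmod_piK !quotmod_scaleE scalerDl raddfD.
Qed.

HB.instance Definition _ (N : submod M) :=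
  GRing.Zmodule_isLmodule.Build A (quotmod N) (@quotmod_scaleA N)
    (@quotmod_scale1 N) (@quotmod_scaleDr N) (@quotmod_scaleDl N).

Lemma quotmod_piZ (N : submod M) : scalable (quotmod_pi N).
Proof. by move=> a x; rewrite -quotmod_scaleE. Qed.

HB.instance Definition _ (N : submod M) :=
  GRing.isScalable.Build A M (quotmod N) *:%R (quotmod_pi N) (@quotmod_piZ N).

End SubQuotient.

Section Modules.
Context {A : nzRingType}.
Implicit Types M N : lmodType A.

Lemma subquot_closed M (L N : submod M) :
  submod_closed [pred x : submod_type L | val x \in N].
Proof.
split=> [|a x y]; rewrite !inE ?raddf0 ?rpred0 // => xN yN.
by rewrite linearP rpredD // rpredZ.
Qed.

(* L / (L :&: N), that is L / N when N is contained in L. *)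
Definition subquot M (L N : submod M) : lmodType A :=
  quotmod (Submod (subquot_closed L N)).

Definition isomorphic M N := exists f : {linear M -> N}, bijective f.

Definition fin_gen M :=
  exists s : seq M, forall x,
    exists a : 'I_(size s) -> A, x = \sum_i a i *: s`_i.

Definition short_exact L M N (f : {linear L -> M}) (g : {linear M -> N}) :=
  [/\ injective f, (forall y, g y = 0 <-> exists x, y = f x)
    & (forall z, exists y, z = g y)].

(* 0 = F 0 <= F 1 <= ... <= F n = M with every F i.+1 / F i satisfying D. *)
Definition filtration (D : lmodType A -> Prop) M n (F : nat -> submod M) :=
  [/\ F 0%N =i pred1 0, F n =i predT,
      (forall i, (i < n)%N -> {subset F i <= F i.+1})
    & (forall i, (i < n)%N -> D (subquot (F i.+1) (F i)))].

Definition filtered D M :=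
  exists n (F : nat -> submod M), filtration D n F.

Definition simple M :=
  (exists x : M, x <> 0) /\
  (forall N : submod M, N =i pred1 0 \/ N =i predT).

Definition composition_factor M S :=
  exists n (F : nat -> submod M),
    filtration simple n F /\
    exists2 i, (i < n)%N & isomorphic (subquot (F i.+1) (F i)) S.

Definition maximal_submod M (N : submod M) :=
  (exists x, x \notin N) /\
  (forall L : submod M, {subset N <= L} -> L =i N \/ L =i predT).

Lemma rad_closed M :
  submod_closed
    [pred x : M | `[< forall N : submod M, maximal_submod N -> x \in N >]].
Proof.
split=> [|a x y]; rewrite !inE.
  by apply/asboolP => N _; rewrite rpred0.
move=> /asboolP xR /asboolP yR; apply/asboolP => N maxN.
by rewrite rpredD ?rpredZ ?xR ?yR.
Qed.

Definition rad M : submod M := Submod (@rad_closed M).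

Lemma principal_closed (e : A) :
  submod_closed [pred x : A^o | `[< exists a : A, x = a * e >]].
Proof.
split=> [|a x y]; rewrite !inE; first by apply/asboolP; exists 0; rewrite mul0r.
move=> /asboolP[b ->] /asboolP[c ->]; apply/asboolP; exists (a * b + c).
by rewrite mulrDl -mulrA.
Qed.

(* A e, a submodule of the left regular module A^o *)
Definition principal (e : A) : lmodType A :=
  submod_type (Submod (principal_closed e)).

Definition idempotent_elt (e : A) := e * e = e.

Definition primitive_idempotent (e : A) :=
  [/\ idempotent_elt e, e <> 0
    & forall f g, idempotent_elt f -> idempotent_elt g ->
        f * g = 0 -> g * f = 0 -> e = f + g -> f = 0 \/ g = 0].

Definition primitive_decomposition (Lambda : finType) (e : Lambda -> A) :=
  [/\ (forall l, primitive_idempotent (e l)),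
      (forall l m, l <> m -> e l * e m = 0)
    & \sum_l e l = 1].

End Modules.

Definition linear_order (T : eqType) (le : rel T) :=
  [/\ reflexive le, antisymmetric le, transitive le & total le].

Section Stratification.
Context {A : nzRingType} {Lambda : finType} (e : Lambda -> A).

Definition Pmod (l : Lambda) : lmodType A := principal (e l).

Definition Smod (l : Lambda) : lmodType A := quotmod (rad (Pmod l)).

(* For a complete set of primitive orthogonal idempotents e: the              *)
(* indecomposable summands of the regular module are pairwise non-isomorphic. *)
Definition basic := forall l m, isomorphic (Pmod l) (Pmod m) -> l = m.

Variable le : rel Lambda.

Definition factors_below (l : Lambda) (M : lmodType A) :=
  forall m, composition_factor M (Smod m) -> le m l.

(* The largest quotient of P_l with this property is the quotient by the      *)
(* smallest submodule.                                                        *)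
Definition standard_kernel (l : Lambda) (K : submod (Pmod l)) :=
  factors_below l (quotmod K) /\
  forall N : submod (Pmod l), factors_below l (quotmod N) -> {subset K <= N}.

Definition standard (l : Lambda) (D : lmodType A) :=
  exists2 K : submod (Pmod l), standard_kernel K & isomorphic D (quotmod K).

Definition in_F (M : lmodType A) :=
  fin_gen M /\ filtered (fun D => exists m, standard m D) M.

Definition standardly_stratified :=
  forall l, exists2 K : submod (Pmod l), standard_kernel K &
    filtered (fun D => exists m, [/\ le l m, l <> m & standard m D])
      (submod_type K : lmodType A).

Definition closed_under_coker_mono :=
  forall (L M N : lmodType A) (f : {linear L -> M}) (g : {linear M -> N}),
    short_exact f g -> in_F L -> in_F M -> in_F N.

End Stratification.

(* Main.v *)
From HB Require Import structures.
Require Import Defs.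
From mathcomp Require Import all_boot all_order all_algebra all_field.
From mathcomp Require Import boolp.

(* Write F = F(le) and F' = F(le'). Since F is closed under extensions and    *)
(* under cokernels of monomorphisms and contains every P_l, descending        *)
(* induction along le' puts every standard module of le' in F: it is the      *)
(* cokernel of K -> P_l, where K is filtered by standard modules of le' with  *)
(* larger index. Hence F' is contained in F, and equality holds by symmetry.  *)

Set Implicit Arguments.
Unset Strict Implicit.
Unset Printing Implicit Defensive.

Import GRing.Theory.
Local Open Scope ring_scope.

(** The engine is the exact sequence 0 -> K -> P_l -> D -> 0, with D standard for [le'] at l and K
    filtered by standard modules of [le'] at indices above l. The middle term lies in F by
    [in_F_Pmod]: stratification for [le] filters the kernel of P_l onto its own standard quotient,
    which sits on top. The left term lies in F by induction; for maximal l it is 0. Closure under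
    cokernels then gives D in F ([standard_in_F]), and [in_F_sub] passes from standard modules to
    all of F'.

    Both passages use that a module filtered by objects of F is in F ([in_F_filtered]). Filtrations
    are refined by pulling a filtration of each factor back along the quotient map
    ([chain_pullback], [filtered_trans]), and generators are lifted factor by factor
    ([fin_gen_filtered]). *)

Section Isomorphisms.
Context {A : nzRingType}.
Implicit Types M N : lmodType A.

(** A linear relation, total on both sides and matching 0 only with 0, is the graph of an
    isomorphism: differences of related pairs are related, so values and antecedents are unique.
    This avoids checking that maps out of quotients are well defined. *)
Lemma isomorphic_rel M N (R : M -> N -> Prop) :
  (forall a x y x' y', R x y -> R x' y' -> R (a *: x + x') (a *: y + y')) ->
  (forall x, exists y, R x y) -> (forall y, exists x, R x y) ->
  (forall x y, R x y -> x = 0 <-> y = 0) ->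
  isomorphic M N.
Proof.
move=> Rlin Rl Rr R0.
have Rsub x y x' y' : R x y -> R x' y' -> R (x' - x) (y' - y).
  by move=> r r'; have := Rlin (-1) _ _ _ _ r r'; rewrite !scaleN1r ![- _ + _]addrC.
have Rfun x y y' : R x y -> R x y' -> y = y'.
  move=> r r'; apply/esym/eqP; rewrite -subr_eq0; apply/eqP.
  by apply/(R0 _ _ (Rsub _ _ _ _ r r')); rewrite subrr.
have Rinj x x' y : R x y -> R x' y -> x = x'.
  move=> r r'; apply/esym/eqP; rewrite -subr_eq0; apply/eqP.
  by apply/(R0 _ _ (Rsub _ _ _ _ r r')); rewrite subrr.
pose f x := projT1 (cid (Rl x)); have fP x : R x (f x) := projT2 (cid (Rl x)).
pose h y := projT1 (cid (Rr y)); have hP y : R (h y) y := projT2 (cid (Rr y)).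
have f_lin : linear f by move=> a x y; apply: (Rfun (a *: x + y)) => //; apply: Rlin.
pose fL := GRing.isLinear.Build A M N _ f f_lin.
pose F : {linear M -> N} := HB.pack f fL.
exists F; exists h => x; first exact: Rinj (hP (f x)) (fP x).
exact: Rfun (fP (h x)) (hP x).
Qed.

Lemma isomorphic_trans M N P :
  isomorphic M N -> isomorphic N P -> isomorphic M P.
Proof. by move=> [f bf] [g bg]; exists (g \o f); apply: bij_comp. Qed.

Lemma isomorphic_sym M N : isomorphic M N -> isomorphic N M.
Proof.
move=> [f bf]; have [h fK hK] := bf.
apply: (@isomorphic_rel _ _ (fun y x => f x = y)).
- by move=> a _ x _ x' <- <-; rewrite linearP.
- by move=> y; exists (h y).
- by move=> x; exists (f x).
- move=> _ x <-; split=> [|->]; last exact: linear0.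
  by move=> fx0; apply: (bij_inj bf); rewrite fx0 linear0.
Qed.

Definition iso_closed (D : lmodType A -> Prop) :=
  forall M N, isomorphic M N -> D N -> D M.

Lemma quotmod_pi_eq0 M (N : submod M) x : (quotmod_pi N x == 0) = (x \in N).
Proof. by rewrite -(raddf0 (quotmod_pi N)) quotmod_piE subr0. Qed.

Lemma subquot_pi_eq0 M (Z Y : submod M) (v : submod_type Z) :
  (quotmod_pi (Submod (subquot_closed Z Y)) v == 0) = (val v \in Y).
Proof. by rewrite quotmod_pi_eq0. Qed.

End Isomorphisms.

(** * Filtrations between two submodules *)

Section Chains.
Context {A : nzRingType} {M : lmodType A}.
Implicit Types (D : lmodType A -> Prop) (X Y Z : submod M).

Lemma submod_ext X Y : X =i Y -> X = Y.
Proof.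
case: X Y => [p pP] [q qP] pq; have {pq} E : p = q by apply: funext => x; exact: pq.
by case: q / E qP => qP; congr Submod; exact: Prop_irrelevance.
Qed.

Lemma zero_submod_closed : submod_closed (pred1 (0 : M)).
Proof.
split=> [|a x y]; rewrite !inE // => /eqP-> /eqP->.
by rewrite scaler0 addr0.
Qed.

Definition zero_submod : submod M := Submod zero_submod_closed.

Lemma full_submod_closed : submod_closed (predT : {pred M}).
Proof. by []. Qed.

Definition full_submod : submod M := Submod full_submod_closed.

(** The endpoints are arbitrary rather than 0 and M, so that a single step of a filtration can be
    replaced by a chain and chains can be concatenated. *)
Inductive chain D X : submod M -> Prop :=
| chain_nil : chain D X X
| chain_snoc Y Z :
    chain D X Y -> {subset Y <= Z} -> D (subquot Z Y) -> chain D X Z.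

Lemma chain_cat D X Y Z : chain D X Y -> chain D Y Z -> chain D X Z.
Proof. by move=> cXY; elim=> // Y' Z' _ IH; apply: chain_snoc. Qed.

Lemma filteredP D : filtered D M <-> chain D zero_submod full_submod.
Proof.
split=> [[n [F [F0 Fn Fsub FD]]]|].
  have <- : F 0%N = zero_submod by apply: submod_ext.
  have <- : F n = full_submod by apply: submod_ext.
  (* Only the endpoint varies in the induction: each initial segment of [F] is a chain from
     [F 0]. *)
  have : (n <= n)%N by []; elim: {-2}n => [|i IH] lt_in; first exact: chain_nil.
  by apply: chain_snoc (Fsub i lt_in) (FD i lt_in); apply/IH/ltnW.
suff main X Y : chain D X Y -> exists n (F : nat -> submod M),
    [/\ F 0%N = X, F n = Y, (forall i, (i < n)%N -> {subset F i <= F i.+1})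
      & (forall i, (i < n)%N -> D (subquot (F i.+1) (F i)))].
  by move=> /main[n [F [F0 Fn Fsub FD]]]; exists n, F; split; rewrite ?F0 ?Fn.
elim=> [|{}Y Z _ [n [F [F0 Fn Fsub FD]]] YZ DYZ]; first by exists 0%N, (fun=> X).
exists n.+1, (fun i => if (i <= n)%N then F i else Z); split=> //.
- by rewrite ltnn.
- move=> i; rewrite ltnS => le_in; rewrite le_in.
  case: ltnP => [/Fsub //|ge_in].
  have -> : i = n by apply/eqP; rewrite eqn_leq le_in.
  by rewrite Fn.
- move=> i; rewrite ltnS => le_in; rewrite le_in.
  case: ltnP => [/FD //|ge_in].
  have -> : i = n by apply/eqP; rewrite eqn_leq le_in.
  by rewrite Fn.
Qed.

End Chains.

(** * Pulling back and refining filtrations; finite generation *)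

Section Extensions.
Context {A : nzRingType} {M : lmodType A}.
Implicit Types (D : lmodType A -> Prop) (X Y Z : submod M).

Section Preimage.
Context {N : lmodType A} {Y : submod M} (g : {linear submod_type Y -> N}).
Implicit Type H : submod N.

Lemma preimage_closed H :
  submod_closed [pred x : M |
    `[< exists2 y : submod_type Y, val y = x & g y \in H >]].
Proof.
split=> [|a x x']; rewrite !inE.
  by apply/asboolP; exists 0; rewrite ?raddf0 ?rpred0.
move=> /asboolP[y <- gy] /asboolP[y' <- gy']; apply/asboolP.
by exists (a *: y + y'); rewrite linearP // rpredD ?rpredZ.
Qed.

(** Although [g] lives on [Y] only, the preimage is taken inside [M], so that it can serve as a term
    of a chain in [M]. *)
Definition preimage_submod H : submod M := Submod (preimage_closed H).

Lemma preimageP H x :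
  reflect (exists2 y : submod_type Y, val y = x & g y \in H)
          (x \in preimage_submod H).
Proof. exact: asboolP. Qed.

Hypothesis g_surj : forall z, exists y, g y = z.

Lemma subquot_preimage H H' :
  isomorphic (subquot (preimage_submod H') (preimage_submod H)) (subquot H' H).
Proof.
pose pi1 := quotmod_pi (Submod
  (subquot_closed (preimage_submod H') (preimage_submod H))).
pose pi2 := quotmod_pi (Submod (subquot_closed H' H)).
(* Two classes correspond when a common [y] represents the first and [g y] the second. *)
apply: (@isomorphic_rel _ _ _ (fun p q => exists v w (y : submod_type Y),
  [/\ p = pi1 v, q = pi2 w, val v = val y & val w = g y])).
- move=> a _ _ _ _ [v [w [y [-> -> vy wy]]]] [v' [w' [y' [-> -> vy' wy']]]].
  exists (a *: v + v'), (a *: w + w'), (a *: y + y').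
  by split; rewrite /pi1 /pi2 !linearP /= ?(vy, vy', wy, wy').
- move=> p; set v := repr p; have /preimageP[y yv gy] := valP v.
  by exists (pi2 (Sub (g y) gy)), v, (Sub (g y) gy), y; rewrite /pi1 quotmod_piK.
- move=> q; set w := repr q; have [y gy] := g_surj (val w).
  have yP : val y \in preimage_submod H'.
    by apply/preimageP; exists y => //; rewrite gy; exact: valP.
  by exists (pi1 (Sub (val y) yP)), (Sub (val y) yP), w, y; rewrite /pi2 quotmod_piK.
- move=> _ _ [v [w [y [-> -> vy wy]]]].
  suff E : (pi1 v == 0) = (pi2 w == 0) by split=> /eqP ?; apply/eqP; [rewrite -E | rewrite E].
  rewrite !subquot_pi_eq0 vy wy.
  apply/preimageP/idP => [[y' /val_inj-> //]|gy]; by exists y.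
Qed.

Lemma chain_preimage D H H' : iso_closed D -> chain D H H' ->
  chain D (preimage_submod H) (preimage_submod H').
Proof.
move=> isoD; elim=> [|H1 H2 _ IH H12 D12]; first exact: chain_nil.
apply: chain_snoc IH _ (isoD _ _ (subquot_preimage _ _) D12).
by move=> x /preimageP[y yx /H12 gy]; apply/preimageP; exists y.
Qed.

End Preimage.

Lemma chain_pullback D (N : lmodType A) X Y (g : {linear submod_type Y -> N}) :
  iso_closed D -> {subset X <= Y} -> (forall z, exists y, g y = z) ->
  (forall y, (g y == 0) = (val y \in X)) -> filtered D N -> chain D X Y.
Proof.
move=> isoD XY g_surj g0 /filteredP/(chain_preimage g_surj isoD).
congr (chain D _ _); apply: submod_ext => x.
  apply/preimageP/idP => [[y <-]|Xx]; first by rewrite inE g0.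
  by exists (Sub x (XY _ Xx)); rewrite // inE g0.
apply/preimageP/idP => [[y <- _]|Yx]; first exact: valP.
by exists (Sub x Yx).
Qed.

(** Each step from [Y] to [Z] is refined by pulling the filtration of Z/Y back along Z -> Z/Y. *)
Lemma filtered_trans D : iso_closed D -> filtered (filtered D) M -> filtered D M.
Proof.
move=> isoD /filteredP flt; apply/filteredP.
elim: flt => [|Y Z _ IH YZ DYZ]; first exact: chain_nil.
apply: chain_cat IH _.
apply: (@chain_pullback _ _ _ _ (quotmod_pi (Submod (subquot_closed Z Y)))) => //.
  by move=> z; exists (repr z); exact: quotmod_piK.
by move=> y; rewrite subquot_pi_eq0.
Qed.

Lemma subquot_full Y : isomorphic (subquot full_submod Y) (quotmod Y).
Proof.
pose pi1 := quotmod_pi (Submod (subquot_closed full_submod Y)).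
apply: (@isomorphic_rel _ _ _ (fun p q => exists v,
  p = pi1 v /\ q = quotmod_pi Y (val v))).
- move=> a _ _ _ _ [v [-> ->]] [w [-> ->]].
  by exists (a *: v + w); split; rewrite ?/pi1 !linearP.
- move=> p; set v : submod_type full_submod := repr p.
  by exists (quotmod_pi Y (val v)), v; rewrite /pi1 quotmod_piK.
- move=> q; have v_full : repr q \in full_submod by [].
  by exists (pi1 (Sub (repr q) v_full)), (Sub (repr q) v_full); rewrite quotmod_piK.
- move=> _ _ [v [-> ->]].
  suff E : (pi1 v == 0) = (quotmod_pi Y (val v) == 0).
    by split=> /eqP ?; apply/eqP; [rewrite -E | rewrite E].
  by rewrite subquot_pi_eq0 quotmod_pi_eq0.
Qed.

Lemma filtered_extension D Y :
  iso_closed D -> filtered D (submod_type Y) -> D (quotmod Y) -> filtered D M.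
Proof.
move=> isoD fltY DY; apply/filteredP.
apply: chain_snoc (isoD _ _ (subquot_full Y) DY); last by [].
apply: (@chain_pullback _ _ _ _ (idfun : {linear submod_type Y -> submod_type Y})) => //.
- by move=> x /eqP->; exact: rpred0.
- by move=> y; exists y.
Qed.

(** Trades coefficients for a minimality property of the generated submodule, which passes easily
    through quotients. *)
Lemma fin_genP :
  fin_gen M <-> exists s : seq M,
    forall N : submod M, {subset s <= N} -> forall x, x \in N.
Proof.
split=> [[s sP]|[s sP]]; exists s.
  move=> N sN x; have [a ->] := sP x.
  by apply: rpred_sum => i _; rewrite rpredZ // sN // mem_nth.
move=> x; pose comb := [pred x : M |
  `[< exists a : 'I_(size s) -> A, x = \sum_i a i *: s`_i >]].
have comb_closed : submod_closed comb.
  split=> [|b y z]; rewrite !inE.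
    by apply/asboolP; exists (fun=> 0); rewrite big1 // => i _; rewrite scale0r.
  move=> /asboolP[c ->] /asboolP[d ->]; apply/asboolP.
  exists (fun i => b * c i + d i); rewrite scaler_sumr -big_split.
  by apply: eq_bigr => i _; rewrite /= scalerDl scalerA.
suff /asboolP : x \in Submod comb_closed by [].
apply: sP => y sy; apply/asboolP; have i_lt : (index y s < size s)%N by rewrite index_mem.
exists (fun i => (i == Ordinal i_lt)%:R); rewrite (bigD1 (Ordinal i_lt)) //= eqxx scale1r.
by rewrite nth_index // big1 ?addr0 // => i /negPf->; rewrite scale0r.
Qed.

End Extensions.

Lemma filtered_mono {A : nzRingType} (D D' : lmodType A -> Prop) M :
  (forall N, D N -> D' N) -> filtered D M -> filtered D' M.
Proof.
move=> DD' [n [F [F0 Fn Fsub FD]]]; exists n, F.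
by split=> // i lt_in; apply/DD'/FD.
Qed.

Lemma fin_gen_filtered {A : nzRingType} (M : lmodType A) :
  filtered fin_gen M -> fin_gen M.
Proof.
move=> /filteredP flt; apply/fin_genP.
suff [s sP] : exists s : seq M,
    forall N : submod M, {subset s <= N} -> {subset full_submod <= N}.
  by exists s => N sN x; apply: sP.
elim: flt => [|Y Z _ [s sP] YZ /fin_genP[t tP]].
  by exists [::] => N _ x /eqP->; exact: rpred0.
(* Generators of [Y] together with lifts of generators of Z/Y. Below, [im] is the image in Z/Y of
   the part of [N] inside [Z]; it contains [t], hence is everything. *)
exists (s ++ [seq val (repr q) | q <- t]) => N stN.
have YN : {subset Y <= N} by apply: sP => x sx; apply: stN; rewrite mem_cat sx.
pose pi := quotmod_pi (Submod (subquot_closed Z Y)).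
pose im := [pred q : subquot Z Y |
  `[< exists2 v : submod_type Z, q = pi v & val v \in N >]].
have im_closed : submod_closed im.
  split=> [|a p q]; rewrite !inE.
    by apply/asboolP; exists 0; rewrite /pi ?raddf0 ?rpred0.
  move=> /asboolP[v -> vN] /asboolP[w -> wN]; apply/asboolP.
  by exists (a *: v + w); rewrite /pi !linearP //= rpredD ?rpredZ.
have imT : forall q, q \in Submod im_closed.
  apply: tP => q tq; apply/asboolP; exists (repr q); first by rewrite /pi quotmod_piK.
  by apply: stN; rewrite mem_cat; apply/orP; right; apply/mapP; exists q.
move=> x xZ; have /asboolP[v /eqP + vN] := imT (pi (Sub x xZ)).
rewrite quotmod_piE inE raddfB /= => /YN xvN.
by rewrite -(subrK (val v) x) rpredD.
Qed.

(** * Comparing the two families of standard modules *)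

Section StandardFiltrations.
Context {A : nzRingType} {Lambda : finType} (e : Lambda -> A).
Implicit Types le : rel Lambda.

Lemma iso_closed_standard le :
  iso_closed (fun D => exists m, standard e le m D).
Proof.
move=> M N MN [m [K KP NK]]; exists m, K => //.
exact: isomorphic_trans MN NK.
Qed.

Lemma in_F_filtered le M : filtered (in_F e le) M -> in_F e le M.
Proof.
move=> flt; split; first by apply/fin_gen_filtered/(filtered_mono _ flt) => N [].
apply: filtered_trans (@iso_closed_standard le) _.
by apply: filtered_mono flt => N [].
Qed.

Lemma fin_gen_Pmod l : fin_gen (Pmod e l).
Proof.
have eP : e l \in Submod (principal_closed (e l)).
  by apply/asboolP; exists 1; rewrite mul1r.
apply/fin_genP; exists [:: (SubmodType eP : Pmod e l)] => N eN x.
have /asboolP[a xE] := valP x.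
have -> : x = a *: (SubmodType eP : Pmod e l) by apply: val_inj; rewrite xE linearZ.
by rewrite rpredZ // eN ?mem_head.
Qed.

Lemma in_F_Pmod le l : standardly_stratified e le -> in_F e le (Pmod e l).
Proof.
move=> strat; split; first exact: fin_gen_Pmod.
have [K KP fltK] := strat l; apply: (@filtered_extension _ _ _ K).
- exact: iso_closed_standard.
- by apply: filtered_mono fltK => N [m [_ _ mN]]; exists m.
- by exists l, K => //; exists idfun; exists idfun.
Qed.

Lemma standard_kernel_uniq le l (K K' : submod (Pmod e l)) :
  standard_kernel le K -> standard_kernel le K' -> K = K'.
Proof.
move=> [K0 Kmin] [K'0 K'min]; apply: submod_ext => x.
by apply/idP/idP; [apply: Kmin | apply: K'min].
Qed.

Lemma standard_in_F le le' l D :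
  standardly_stratified e le -> closed_under_coker_mono e le ->
  linear_order le' -> standardly_stratified e le' ->
  standard e le' l D -> in_F e le D.
Proof.
move=> strat coker [refl' anti' trans' _] strat'.
(* Descending induction along [le'], measured by the number of indices above [l]. *)
have [n] := ubnP #|[pred m | le' l m]|; elim: n l D => // n IH l D lt_n lD.
have [K KP fltK] := strat' l; have [K' K'P] := lD.
(* The kernel defining [D] and the one filtered by stratification are the same submodule. *)
rewrite -(standard_kernel_uniq KP K'P) => /isomorphic_sym[g bij_g].
have [h gK hK] := bij_g.
apply: (coker _ _ _ (val : {linear submod_type K -> Pmod e l}) (g \o quotmod_pi K)).
- split; first exact: val_inj.
    move=> y; rewrite /=; split=> [|[x ->]].
      rewrite -[0](raddf0 g) => /(bij_inj bij_g)/eqP.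
      rewrite quotmod_pi_eq0 => yK.
      by exists (Sub y yK).
    rewrite -(raddf0 g); congr (g _); apply/eqP.
    by rewrite quotmod_pi_eq0 (valP x).
  by move=> z; exists (repr (h z)); rewrite /= quotmod_piK hK.
- apply/in_F_filtered/(filtered_mono _ fltK) => N [m [lm neq_lm mN]].
  (* Indices above [m] are above [l] by transitivity, and [l] itself is lost by antisymmetry, so the
     measure drops. *)
  apply: IH mN; rewrite -ltnS; apply: leq_trans lt_n; rewrite ltnS.
  apply/proper_card/properP; split.
    by apply/subsetP => p; rewrite !inE; apply: trans'.
  exists l; rewrite !inE ?refl' //; apply/negP => ml.
  by apply: neq_lm; apply: anti'; rewrite lm ml.
- exact: in_F_Pmod.
Qed.

Lemma in_F_sub le le' M :
  standardly_stratified e le -> closed_under_coker_mono e le ->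
  linear_order le' -> standardly_stratified e le' ->
  in_F e le' M -> in_F e le M.
Proof.
move=> strat coker lin' strat' [_ fltM].
apply/in_F_filtered/(filtered_mono _ fltM) => N [m].
exact: standard_in_F.
Qed.

End StandardFiltrations.

Theorem corollary3p4 (k : closedFieldType) (A : falgType k) (Lambda : finType)
    (e : Lambda -> A) (le le' : rel Lambda) :
  primitive_decomposition e -> basic e ->
  linear_order le -> linear_order le' -> ~ (le =2 le') ->
  standardly_stratified e le -> standardly_stratified e le' ->
  closed_under_coker_mono e le -> closed_under_coker_mono e le' ->
  forall M : lmodType A, in_F e le M <-> in_F e le' M.
Proof.
move=> _ _ lin lin' _ strat strat' coker coker' M.
by split; apply: in_F_sub.
Qed.
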